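(* Let $\varepsilon\in(3-2\sqrt2,\,1/3]$ and let $C_\varepsilon$ be the middle-$\varepsilon$ Cantor set. Then the longest arithmetic progression contained in $C_\varepsilon$ has length exactly four; that is, there exist $x\in\mathbb R$ and $t>0$ with $x,x+t,x+2t,x+3t\in C_\varepsilon$, and for every $k\ge5$ there are no $x\in\mathbb R$ and $t>0$ with $x,x+t,\ldots,x+(k-1)t\in C_\varepsilon$.
   Context: For $0<\varepsilon<1$ put $\lambda=(1-\varepsilon)/2$. The middle-$\varepsilon$ Cantor set $C_\varepsilon\subset[0,1]$ is the attractor of the maps $f_0(x)=\lambda x$ and $f_1(x)=1-\lambda+\lambda x$, i.e. the unique nonempty compact set with $C_\varepsilon=f_0(C_\varepsilon)\cup f_1(C_\varepsilon)$. Arithmetic progressions are nontrivial (common difference $t>0$). *)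

(* Defs.v *)
From HB Require Import structures.
From mathcomp Require Import all_boot all_order all_algebra.
From mathcomp Require Import all_classical all_reals all_analysis.
From mathcomp Require Import ring lra.
Set Implicit Arguments.
Unset Strict Implicit.
Unset Printing Implicit Defensive.
Import Order.TTheory GRing.Theory Num.Theory.
Import numFieldNormedType.Exports.
Local Open Scope classical_set_scope.
Local Open Scope ring_scope.

Definition ratio (R : realType) (eps : R) : R := (1 - eps) / 2.

Definition f0 (R : realType) (eps : R) (x : R) : R := ratio eps * x.

Definition f1 (R : realType) (eps : R) (x : R) : R :=
  1 - ratio eps + ratio eps * x.

Definition hutchinson (R : realType) (eps : R) (A : set R) : set R :=
  (f0 eps @` A) `|` (f1 eps @` A).

Definition is_attractor (R : realType) (eps : R) (A : set R) : Prop :=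
  [/\ A !=set0, compact A & A = hutchinson eps A].

(* [get P] is an arbitrary element of [P] when [P] is inhabited. For
   [0 < eps < 1] the attractor exists and is unique, see [cantorP] and
   [cantor_unique] below. *)
Definition cantor (R : realType) (eps : R) : set R :=
  get [set A : set R | is_attractor eps A].

Definition contains_AP (R : realType) (A : set R) (k : nat) : Prop :=
  exists x t : R, 0 < t /\ forall i : nat, (i < k)%N -> A (x + i%:R * t).

Lemma attractor_exists (R : realType) (eps : R) :
  0 < eps < 1 -> exists A : set R, is_attractor eps A.
Proof.
move=> /andP[e0 e1]; set l := ratio eps.
have [l0 l1] : 0 < l /\ 2 * l < 1 by rewrite /l /ratio; split; lra.
pose J : set R := [set` `[0, 1]].
pose K n := iter n (hutchinson eps) J.
have IE x : J x <-> 0 <= x <= 1 by rewrite /J /= in_itv.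
have FI A : A `<=` J -> hutchinson eps A `<=` J.
  move=> AI x [] [y /AI/IE/andP[y0 y1] <-]; apply/IE;
    rewrite /f0 /f1 -/l; apply/andP; split; nra.
have KI n : K n `<=` J by elim: n => [|n IH] //=; exact: FI.
exists (\bigcap_n K n); split.
- exists 0 => n _; elim: n => [|n IH]; first by apply/IE; rewrite lexx ler01.
  by left; exists 0 => //; rewrite /f0 mulr0.
- have cK n : compact (K n).
    elim: n => [|n IH]; first exact: segment_compact.
    apply: compactU; apply: continuous_compact => //;
      apply: continuous_subspaceT => x.
      by apply: cvgM; [exact: cvg_cst | exact: cvg_id].
    apply: cvgD; first exact: cvg_cst.
    by apply: cvgM; [exact: cvg_cst | exact: cvg_id].
  apply: (@subclosed_compact _ _ J).
  + apply: closed_bigI => n _.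
    by apply: compact_closed; [exact: norm_hausdorff | exact: cK].
  + exact: segment_compact.
  + by move=> x Kx; exact: (Kx 0%N).
- apply/seteqP; split => [x Kx|x].
    have: K 1%N x by exact: Kx.
    case=> -[y /IE/andP[y0 y1] xE]; [left|right]; exists y => // n _;
      have [] : K n.+1 x by exact: Kx.
    + case=> z Kz zx; suff -> : y = z by [].
      have : l * y = l * z by rewrite -[RHS]/(f0 eps z) zx -xE.
      by move/mulfI; apply; rewrite gt_eqF.
    + case=> z /KI/IE/andP[z0 z1] zx; exfalso.
      by move: xE; rewrite -zx /f0 /f1 -/l => ?; nra.
    + case=> z /KI/IE/andP[z0 z1] zx; exfalso.
      by move: xE; rewrite -zx /f0 /f1 -/l => ?; nra.
    + case=> z Kz zx; suff -> : y = z by [].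
      have : l * y = l * z by move: zx; rewrite -xE /f1 -/l => /addrI.
      by move/mulfI; apply; rewrite gt_eqF.
  have sub y : (\bigcap_n K n) y -> forall n, K n y by move=> h n; exact: h.
  move=> [] [y /sub Ky <-] [|n] _.
  + by apply: (FI _ (KI 0%N)); left; exists y; [exact: Ky|].
  + by left; exists y; [exact: Ky|].
  + by apply: (FI _ (KI 0%N)); right; exists y; [exact: Ky|].
  + by right; exists y; [exact: Ky|].
Qed.

Lemma attractor_sub (R : realType) (eps : R) (A B : set R) :
  0 < eps < 1 -> is_attractor eps A -> is_attractor eps B -> A `<=` B.
Proof.
move=> /andP[e0 e1] [_ cA AE] [[b Bb] cB BE]; set l := ratio eps.
have [l0 l1] : 0 < l /\ l < 1 by rewrite /l /ratio; split; lra.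
have [M [_ MA]] := compact_bounded cA.
have [N [_ NB]] := compact_bounded cB.
pose D := (`|M| + 1) + (`|N| + 1).
have leM : M < `|M| + 1 by rewrite (le_lt_trans (ler_norm _)) ?ltrDl.
have leN : N < `|N| + 1 by rewrite (le_lt_trans (ler_norm _)) ?ltrDl.
have approx n : forall x, A x -> exists2 y, B y & `|x - y| <= D * l ^+ n.
  elim: n => [|n IH] x Ax.
    exists b => //; rewrite expr0 mulr1 (le_trans (ler_normB _ _))// lerD//.
      exact: MA.
    exact: NB.
  have : hutchinson eps A x by rewrite -AE.
  case=> -[x' /IH[y By xy] <-].
    exists (f0 eps y); first by rewrite BE; left; exists y.
    rewrite /f0 -/l -mulrBr normrM (gtr0_norm l0) exprS mulrCA.
    by rewrite ler_pM2l.
  exists (f1 eps y); first by rewrite BE; right; exists y.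
  rewrite /f1 -/l opprD addrACA subrr add0r -mulrBr normrM (gtr0_norm l0).
  by rewrite exprS mulrCA ler_pM2l.
move=> x Ax; have clB : closed B.
  by apply: compact_closed; [exact: norm_hausdorff | exact: cB].
apply: clB => U /nbhs_ballP[e /= e_gt0 eU].
have /cvgrPdist_lt/(_ _ e_gt0)[n _ /(_ n (leqnn n))] :
    @geometric R D l @ \oo --> (0 : R).
  by apply: cvg_geometric; rewrite gtr0_norm.
rewrite sub0r normrN => /(le_lt_trans (ler_norm _)) small.
have [y By xy] := approx n _ Ax.
by exists y; split => //; apply: eU; rewrite /ball /=; exact: le_lt_trans small.
Qed.

Lemma cantorP (R : realType) (eps : R) :
  0 < eps < 1 -> is_attractor eps (cantor eps).
Proof. by move=> /attractor_exists/getPex. Qed.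

Lemma cantor_unique (R : realType) (eps : R) (A : set R) :
  0 < eps < 1 -> is_attractor eps A -> A = cantor eps.
Proof.
move=> he hA; have hC := cantorP he.
by apply/seteqP; split; apply: attractor_sub he _ _.
Qed.

(* Main.v *)
Require Import Defs.
From mathcomp Require Import all_boot all_order all_algebra.
From mathcomp Require Import all_classical all_reals all_analysis.
From mathcomp Require Import ring lra.
Import Order.TTheory GRing.Theory Num.Theory.
Import numFieldNormedType.Exports.
Local Open Scope classical_set_scope.
Local Open Scope ring_scope.

(** Write [l] for the ratio; the hypotheses say [1/3 <= l < sqrt 2 - 1].

    Upper bound: rescaling, one may assume that a progression of length five
    meets both [0, l] and [1 - l, 1], so that [t >= 1 - 2 l > l ^ 2]. By the
    symmetry of the Cantor set, one may also assume that its middle term lies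
    in [0, l]. Its second term then lies in [t, l - t], which is contained in
    the gap (l ^ 2, l - l ^ 2).

    Existence: look for a progression symmetric about 1/2, that is, for [u]
    such that [u] and [3 u - 1] belong to the Cantor set and [u <= l]. With
    [u = f0 (f1 w)] and [3 u - 1 = f0 w'] this asks for a common point of the
    Cantor set and of an affine copy of it of ratio [3 l]. Since [l >= 1/3],
    the thickness is at least one, and such a point exists by an argument
    à la Newhouse: of two intersecting intervals of comparable lengths, the
    shorter one is too long to fit in the gap of the longer one, hence it
    meets one of the two children of the longer one. *)

Lemma geometric_small (R : realType) (D z e : R) :
  0 <= z < 1 -> 0 < e -> exists n, D * z ^+ n < e.
Proof.
move=> /andP[z0 z1] e0.
have /cvgrPdist_lt/(_ _ e0)[n _ /(_ n (leqnn n))] :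
    @geometric R D z @ \oo --> (0 : R).
  by apply: cvg_geometric; rewrite ger0_norm.
by rewrite sub0r normrN => /(le_lt_trans (ler_norm _)) small; exists n.
Qed.

Section MiddleCantor.
Context {R : realType} {eps : R}.
Hypothesis eps01 : 0 < eps < 1.
Let l := Defs.ratio eps.
Let C := cantor eps.

(** * Self-similarity and symmetry of the Cantor set *)

Lemma ratio_bounds : 0 < l < 1 / 2.
Proof.
move: eps01; rewrite /l /Defs.ratio => /andP[? ?].
by apply/andP; split; lra.
Qed.

Lemma cantor_f0 (x : R) : C x -> C (l * x).
Proof.
move=> Cx; have [_ _ CE] := cantorP eps01.
by rewrite /C CE; left; exists x.
Qed.

Lemma cantor_f1 (x : R) : C x -> C (1 - l + l * x).
Proof.
move=> Cx; have [_ _ CE] := cantorP eps01.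
by rewrite /C CE; right; exists x.
Qed.

Lemma cantor_cases (x : R) : C x ->
  (exists2 y, C y & x = l * y) \/ (exists2 y, C y & x = 1 - l + l * y).
Proof.
have [_ _ CE] := cantorP eps01.
by rewrite {1}/C CE => -[] [y Cy <-]; [left|right]; exists y.
Qed.

(** The maximum [M] is [l * y] or [1 - l + l * y] with [y <= M], which forces [M <= 1]; dually for
    the minimum. *)
Lemma cantor_itv (x : R) : C x -> 0 <= x <= 1.
Proof.
have [C0 cC _] := cantorP eps01; have /andP[l0 l2] := ratio_bounds.
have cid : {within C, continuous (id : R -> R)}.
  by apply: continuous_subspaceT => y; exact: cvg_id.
have [M /set_mem CM leM] := compact_EVT_max C0 cC cid.
have [m /set_mem Cm lem] := compact_EVT_min C0 cC cid.
have M1 : M <= 1.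
  by have [] := cantor_cases M CM => -[y /mem_set/leM /= yM]; nra.
have m0 : 0 <= m.
  by have [] := cantor_cases m Cm => -[y /mem_set/lem /= ym]; nra.
move=> /mem_set Cx; apply/andP; split.
  exact: le_trans m0 (lem _ Cx).
exact: le_trans (leM _ Cx) M1.
Qed.

(** Reflection swaps the two maps, so the reflected set is again an attractor, and uniqueness
    applies. *)
Lemma cantor_sym (x : R) : C x -> C (1 - x).
Proof.
have [[c Cc] cC _] := cantorP eps01.
move=> Cx; suff <- : (fun x => 1 - x) @` C = C by exists x.
apply: cantor_unique => //; split.
- by exists (1 - c); exists c.
- apply: continuous_compact => //; apply: continuous_subspaceT => y.
  by apply: cvgB; [exact: cvg_cst | exact: cvg_id].
apply/seteqP; split => [_ [y Cy <-]|z []].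
- have [[z Cz ->]|[z Cz ->]] := cantor_cases y Cy; [right|left];
    (exists (1 - z); first by exists z); rewrite /f0 /f1 -/l; ring.
- move=> [_ [y Cy <-] <-]; exists (1 - l + l * y); first exact: cantor_f1.
  by rewrite /f0 -/l; ring.
- move=> [_ [y Cy <-] <-]; exists (l * y); first exact: cantor_f0.
  by rewrite /f1 -/l; ring.
Qed.

Lemma cantor_left (x : R) : C x -> x < 1 - l -> C (x / l) /\ x <= l.
Proof.
have /andP[l0 l2] := ratio_bounds.
move=> /cantor_cases[[y Cy ->] _|[y /cantor_itv/andP[y0 y1] ->] lt].
  have /andP[y0 y1] := cantor_itv y Cy.
  by rewrite mulrAC mulfV ?gt_eqF// mul1r; split => //; nra.
by exfalso; nra.
Qed.

Lemma cantor_right (x : R) : C x -> l < x ->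
  C ((x - (1 - l)) / l) /\ 1 - l <= x.
Proof.
have /andP[l0 l2] := ratio_bounds.
move=> /cantor_cases[[y /cantor_itv/andP[y0 y1] ->] lt|[y Cy ->] _].
  by exfalso; nra.
have /andP[y0 y1] := cantor_itv y Cy.
rewrite addrC addKr mulrAC mulfV ?gt_eqF// mul1r; split => //; nra.
Qed.

(** * Progressions of length five *)

Lemma cantor_second_gap (x : R) : C x -> l ^+ 2 < x -> x < l - l ^+ 2 -> False.
Proof.
have /andP[l0 l2] := ratio_bounds.
move=> Cx x1 x2; have [|Cy _] := cantor_left x Cx; first by nra.
have : l < x / l by rewrite ltr_pdivlMr.
by move=> /(cantor_right _ Cy)[_]; rewrite ler_pdivlMr//; nra.
Qed.

Lemma no_split_AP5_left (x t : R) : l ^+ 2 + 2 * l < 1 -> 0 < t ->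
  C x -> C (x + t) -> C (x + 2 * t) -> C (x + 3 * t) -> C (x + 4 * t) ->
  x + 2 * t < 1 - l -> 1 - l <= x + 4 * t -> False.
Proof.
move=> lt1 t0 C0 C1 C2 C3 C4 x2 x4; have /andP[l0 l2] := ratio_bounds.
have /andP[x0 _] := cantor_itv _ C0; have [_ x2l] := cantor_left _ C2 x2.
(* The central gap, of length [1 - 2 * l], lies between the third and fourth terms or between the
   fourth and fifth. *)
have t_ge : 1 - 2 * l <= t.
  have [x3|x3] := ltP (x + 3 * t) (1 - l); last by lra.
  by have [_ ?] := cantor_left _ C3 x3; lra.
by apply: (cantor_second_gap (x + t)) => //; lra.
Qed.

(** A progression inside one half can be blown up by [1 / l]. Steps in [C] are bounded, so this
    cannot be iterated forever. *)
Lemma AP5_step (x t : R) : l ^+ 2 + 2 * l < 1 -> 0 < t ->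
  (forall i, (i < 5)%N -> C (x + i%:R * t)) ->
  exists y, forall i, (i < 5)%N -> C (y + i%:R * (t / l)).
Proof.
move=> lt1 t0 Cx; have /andP[l0 l2] := ratio_bounds.
have C0 : C x by rewrite -[x]addr0 -[0](mul0r t); exact: (Cx 0%N).
have C1 : C (x + t) by rewrite -[t]mul1r; exact: (Cx 1%N).
have C2 : C (x + 2 * t) by exact: (Cx 2%N).
have C3 : C (x + 3 * t) by exact: (Cx 3%N).
have C4 : C (x + 4 * t) by exact: (Cx 4%N).
have it i : (i < 5)%N -> 0 <= i%:R * t <= 4 * t.
  move=> i5; apply/andP; split; first by rewrite mulr_ge0// ltW.
  by rewrite ler_pM2r// (ler_nat R i 4).
have [x4|x4] := ltP (x + 4 * t) (1 - l).
  exists (x / l) => i i5; have /andP[_ i4] := it i i5.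
  have [|+ _] := cantor_left _ (Cx i i5); first by lra.
  by rewrite mulrDl mulrA.
have [x0|x0] := ltP l x.
  exists ((x - (1 - l)) / l) => i i5; have /andP[i0 _] := it i i5.
  have [|+ _] := cantor_right _ (Cx i i5); first by lra.
  by rewrite mulrA -mulrDl addrAC.
exfalso; have [x2|x2] := ltP (x + 2 * t) (1 - l).
  exact: (no_split_AP5_left x t).
apply: (no_split_AP5_left (1 - (x + 4 * t)) t) => //.
- exact: cantor_sym.
- by move: (cantor_sym _ C3); congr (C _); ring.
- by move: (cantor_sym _ C2); congr (C _); ring.
- by move: (cantor_sym _ C1); congr (C _); ring.
- by move: (cantor_sym _ C0); congr (C _); ring.
- by lra.
- by lra.
Qed.

Lemma cantor_no_AP5 : l ^+ 2 + 2 * l < 1 -> ~ contains_AP C 5.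
Proof.
move=> lt1 [x [t [t0 Cx]]]; have /andP[l0 l2] := ratio_bounds.
have bound n : forall x t, 0 < t ->
    (forall i, (i < 5)%N -> C (x + i%:R * t)) -> t <= l ^+ n.
  elim: n => [|n IH] {t0 Cx} {}x {}t t0 Cx.
    have /andP[+ _] := cantor_itv _ (Cx 0%N isT).
    by have /andP[_ +] := cantor_itv _ (Cx 4%N isT); rewrite expr0 mul0r; lra.
  have [y Cy] := AP5_step x t lt1 t0 Cx.
  have := IH y (t / l) _ Cy; rewrite divr_gt0// => /(_ isT).
  by rewrite ler_pdivrMr// -exprSr.
have l01 : 0 <= l < 1 by apply/andP; split; lra.
have [n] := geometric_small R 1 l t l01 t0.
by rewrite mul1r ltNge (bound n x t).
Qed.

(** * Intersecting affine copies and progressions of length four *)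

(* Each step replaces the longer interval by one of its children, so that the
   pair of lengths [(s, r)] becomes [(r, l * s)]; as [r <= s], the sum of the
   lengths is multiplied by at most [(1 + l) / 2]. *)
Lemma linked_copies_near (n : nat) (a s b r : R) : 1 / 3 <= l ->
  0 < s -> l * s <= r -> r <= s -> a <= b + r -> b <= a + s ->
  exists x y, [/\ C x, C y &
    `|(a + s * x) - (b + r * y)| <= (s + r) * ((1 + l) / 2) ^+ n].
Proof.
move=> l3; have /andP[l0 l2] := ratio_bounds.
elim: n a s b r => [|n IH] a s b r s0 lsr rs ab ba.
  have [[c Cc] _ _] := cantorP eps01; exists c, c; split => //.
  have /andP[c0 c1] := cantor_itv c Cc.
  by rewrite expr0 mulr1 ler_norml; apply/andP; split; nra.
have r0 : 0 < r by nra.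
have shrink : (r + l * s) * ((1 + l) / 2) ^+ n <=
    (s + r) * ((1 + l) / 2) ^+ n.+1.
  rewrite exprS mulrA ler_wpM2r//; first by apply: exprn_ge0; lra.
  by nra.
have [bl|bl] := leP b (a + l * s).
  have [|||||x [y [Cx Cy xy]]] := IH b r a (l * s) => //; first by nra.
  exists (l * y), x; split => //; first exact: cantor_f0.
  apply: le_trans shrink; rewrite distrC.
  by rewrite (_ : a + s * (l * y) = a + l * s * y)//; ring.
(* The right child is met: the gap has length [s - 2 * l * s <= l * s <= r], by [1 / 3 <= l]. *)
have [|||||x [y [Cx Cy xy]]] := IH b r (a + s - l * s) (l * s) => //.
- by nra.
- by nra.
- by nra.
exists (1 - l + l * y), x; split => //; first exact: cantor_f1.
apply: le_trans shrink; rewrite distrC.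
by rewrite (_ : a + _ = a + s - l * s + l * s * y)//; ring.
Qed.

(** By compactness the distance between the copies is attained; being below a null geometric
    sequence, it is zero. *)
Lemma linked_copies_meet (a s b r : R) : 1 / 3 <= l ->
  0 < s -> l * s <= r -> r <= s -> a <= b + r -> b <= a + s ->
  exists x y, [/\ C x, C y & a + s * x = b + r * y].
Proof.
move=> l3 s0 lsr rs ab ba; have /andP[l0 l2] := ratio_bounds.
have [_ cC _] := cantorP eps01.
pose g (p : R * R) : R := `|(a + s * p.1) - (b + r * p.2)|.
have gc : {within C `*` C, continuous g}.
  apply: continuous_subspaceT => p; apply: cvg_norm.
  apply: cvgB; (apply: cvgD; first exact: cvg_cst).
    by apply: cvgM; [exact: cvg_cst | exact: cvg_fst].
  by apply: cvgM; [exact: cvg_cst | exact: cvg_snd].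
have CC0 : C `*` C !=set0.
  by have [[c Cc] _ _] := cantorP eps01; exists (c, c).
have [[x y] /set_mem[/= Cx Cy] gmin] :=
  compact_EVT_min CC0 (compact_setX cC cC) gc.
exists x, y; split => //; apply/eqP; rewrite -subr_eq0 -normr_le0 leNgt.
apply/negP => e0.
have k01 : 0 <= (1 + l) / 2 < 1 by apply/andP; split; lra.
have [n small] := geometric_small R (s + r) _ _ k01 e0.
have [x' [y' [Cx' Cy' near]]] :=
  linked_copies_near n a s b r l3 s0 lsr rs ab ba.
have le_g : g (x, y) <= g (x', y') by apply/gmin/mem_set.
by move: (le_trans le_g near); rewrite leNgt small.
Qed.

Lemma cantor_AP4 : 1 / 3 <= l -> 3 * l ^+ 2 <= 1 -> contains_AP C 4.
Proof.
move=> l3 ll; have /andP[l0 l2] := ratio_bounds.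
(* The equation [E] reads [3 * u - 1 = l * w']. The length conditions amount to [3 * l ^+ 2 <= 1]
   and [1 / 3 <= l]. *)
have [||||||w [w' [Cw Cw' E]]] :=
  linked_copies_meet (3 * l * (1 - l) - 1) (3 * l ^+ 2) 0 l => //; try nra.
pose u := l * (1 - l + l * w).
have Cu : C u by apply: cantor_f0; exact: cantor_f1.
have Cu' : C (3 * u - 1).
  by rewrite (_ : _ - 1 = l * w'); [exact: cantor_f0 | rewrite /u; lra].
have /andP[w0 w1] := cantor_itv w Cw.
(* The terms are [3 * u - 1], [u] and their reflections; the step is positive because
   [u <= l < 1 / 2]. *)
exists (3 * u - 1), (1 - 2 * u); split; first by rewrite /u; nra.
move=> [|[|[|[|//]]]] _.
- by rewrite mul0r addr0.
- by move: Cu; congr (C _); ring.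
- by move: (cantor_sym _ Cu); congr (C _); ring.
- by move: (cantor_sym _ Cu'); congr (C _); ring.
Qed.

End MiddleCantor.

Theorem theorem2p4 (R : realType) (eps : R) :
  3 - 2 * Num.sqrt 2 < eps -> eps <= 1 / 3 ->
  contains_AP (cantor eps) 4 /\
  forall k : nat, (5 <= k)%N -> ~ contains_AP (cantor eps) k.
Proof.
set q := Num.sqrt 2 => eps_gt eps_le.
have q2 : q ^+ 2 = 2 by rewrite sqr_sqrtr.
have q0 : 0 <= q by exact: sqrtr_ge0.
have eps01 : 0 < eps < 1 by apply/andP; split; nra.
have l3 : 1 / 3 <= Defs.ratio eps by rewrite /Defs.ratio; lra.
have lq : Defs.ratio eps < q - 1 by rewrite /Defs.ratio; lra.
have ll : Defs.ratio eps ^+ 2 + 2 * Defs.ratio eps < 1 by nra.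
(* With [l] the ratio, [l ^+ 2 < 1 - 2 * l <= 1 / 3]. *)
split; first by apply: (cantor_AP4 eps01) => //; lra.
move=> k k5 [x [t [t0 Cx]]]; apply: (cantor_no_AP5 eps01 ll).
by exists x, t; split => // i i5; apply: Cx; exact: leq_trans k5.
Qed.
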